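(* Let $\mathbf{a},\mathbf{b}\in\mathbf{N}_{\geq2}^{\infty}$ and, for $\mathbf{T}\in\mathcal{T}(\mathbf{a})$, let $\omega_{\mathbf{T}}$ be the associated product state of $\mathcal{A}(\mathbf{a})$ with GNS representation $\pi_{\mathbf{T}}$ (and similarly for $\mathcal{T}(\mathbf{b})$ and $\mathcal{T}(\mathbf{a}\cdot\mathbf{b})$). (i) For each $\mathbf{T}\in\mathcal{T}(\mathbf{a})$ and $\mathbf{R}\in\mathcal{T}(\mathbf{b})$, $$\omega_{\mathbf{T}}\otimes_{\varphi}\omega_{\mathbf{R}}=\omega_{\mathbf{T}\boxtimes\mathbf{R}},$$ where $\mathbf{T}\boxtimes\mathbf{R}\in\mathcal{T}(\mathbf{a}\cdot\mathbf{b})$ is defined as $\mathbf{T}\boxtimes\mathbf{R}=(T^{(1)}\boxtimes R^{(1)},T^{(2)}\boxtimes R^{(2)},T^{(3)}\boxtimes R^{(3)},\ldots)$ for $\mathbf{T}=(T^{(n)})$ and $\mathbf{R}=(R^{(n)})$. (ii) For each $\mathbf{T}\in\mathcal{T}(\mathbf{a})$ and $\mathbf{R}\in\mathcal{T}(\mathbf{b})$, $\pi_{\mathbf{T}}\otimes_{\varphi}\pi_{\mathbf{R}}$ is unitarily equivalent to $\pi_{\mathbf{T}\boxtimes\mathbf{R}}$.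
   Context: $\mathbf{N}_{\geq2}^{\infty}$ is the set of all sequences in $\{2,3,4,\ldots\}$, with product $\mathbf{a}\cdot\mathbf{b}=(a_1b_1,a_2b_2,\ldots)$. $M_n$ is the algebra of $n\times n$ complex matrices with standard matrix units $E^{(n)}_{i,j}$. For $\mathbf{a}=(a_1,a_2,\ldots)\in\mathbf{N}_{\geq2}^{\infty}$, $\mathcal{A}_n(\mathbf{a})=\bigotimes_{j=1}^nM_{a_j}$, embedded in $\mathcal{A}_{n+1}(\mathbf{a})$ by $A\mapsto A\otimes I$, and $\mathcal{A}(\mathbf{a})=\varinjlim\mathcal{A}_n(\mathbf{a})$ (C$^*$-inductive limit). Tensor products of C$^*$-algebras are minimal. $\varphi_{\mathbf{a},\mathbf{b}}:\mathcal{A}(\mathbf{a}\cdot\mathbf{b})\to\mathcal{A}(\mathbf{a})\otimes\mathcal{A}(\mathbf{b})$ is the unique $*$-isomorphism such that for all $n\geq1$ and $j_i,k_i\in\{1,\ldots,a_ib_i\}$, $$\varphi_{\mathbf{a},\mathbf{b}}(E^{(a_1b_1)}_{j_1,k_1}\otimes\cdots\otimes E^{(a_nb_n)}_{j_n,k_n})=(E^{(a_1)}_{j_1',k_1'}\otimes\cdots\otimes E^{(a_n)}_{j_n',k_n'})\otimes(E^{(b_1)}_{j_1'',k_1''}\otimes\cdots\otimes E^{(b_n)}_{j_n'',k_n''}),$$ where $j_i=b_i(j_i'-1)+j_i''$, $k_i=b_i(k_i'-1)+k_i''$ with $j_i',k_i'\in\{1,\ldots,a_i\}$, $j_i'',k_i''\in\{1,\ldots,b_i\}$.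 For $*$-representations $\pi_1$ of $\mathcal{A}(\mathbf{a})$ and $\pi_2$ of $\mathcal{A}(\mathbf{b})$, $\pi_1\otimes_{\varphi}\pi_2=(\pi_1\otimes\pi_2)\circ\varphi_{\mathbf{a},\mathbf{b}}$, a representation of $\mathcal{A}(\mathbf{a}\cdot\mathbf{b})$. For states $\rho_1$ of $\mathcal{A}(\mathbf{a})$ and $\rho_2$ of $\mathcal{A}(\mathbf{b})$, $\rho_1\otimes_{\varphi}\rho_2=(\rho_1\otimes\rho_2)\circ\varphi_{\mathbf{a},\mathbf{b}}$, a state of $\mathcal{A}(\mathbf{a}\cdot\mathbf{b})$. $M_{n,+,1}$ is the set of positive elements of $M_n$ with trace $1$, and $\mathcal{T}(\mathbf{a})=\prod_{n\geq1}M_{a_n,+,1}$. For $\mathbf{T}=(T^{(n)})_{n\geq1}\in\mathcal{T}(\mathbf{a})$, $\omega_{\mathbf{T}}$ is the state of $\mathcal{A}(\mathbf{a})$ determined by $\omega_{\mathbf{T}}(E^{(a_1)}_{j_1,k_1}\otimes\cdots\otimes E^{(a_n)}_{j_n,k_n})=T^{(1)}_{k_1,j_1}\cdots T^{(n)}_{k_n,j_n}$ for all indices and $n\geq1$ (i.e. the product of the states $x\mapsto\mathrm{tr}(T^{(n)}x)$). Kronecker product: for $A\in M_n$, $B\in M_m$, $A\boxtimes B\in M_{nm}$ is given by $(A\boxtimes B)_{m(i-1)+i',m(j-1)+j'}=A_{i,j}B_{i',j'}$ for $i,j\in\{1,\ldots,n\}$, $i',j'\in\{1,\ldots,m\}$.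 *)

(* Defs.v *)
From HB Require Import structures.
From mathcomp Require Import all_boot all_order all_algebra.
From mathcomp Require Import sesquilinear.
From mathcomp Require Import complex mxtens.
From mathcomp Require Import boolp classical_sets reals topology normedtype.

Set Implicit Arguments.
Unset Strict Implicit.
Unset Printing Implicit Defensive.
Import Order.TTheory GRing.Theory Num.Theory.
Import numFieldNormedType.Exports.
Local Open Scope classical_set_scope.
Local Open Scope ring_scope.

(** * C*-algebras and Hilbert spaces *)

(* The norm of a normed module over R[i] is R[i]-valued; in the order of R[i],
   0 <= z means that z is a nonnegative real number. *)
(* Unital C*-algebras. The product is a field of its own, since MathComp has no
   join of its normed modules with its rings. *)
HB.mixin Record isCStarAlgebra (R : realType) A
    of CompleteNormedModule R[i] A := {
  cmul : {bilinear A -> A -> A};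
  cone : A;
  star : A -> A;
  cmulA : associative cmul;
  cmul1l : left_id cone cmul;
  cmul1r : right_id cone cmul;
  starD : {morph star : x y / x + y};
  starZ : forall (c : R[i]) x, star (c *: x) = c^* *: star x;
  starM : forall x y, star (cmul x y) = cmul (star y) (star x);
  starK : involutive star;
  cnormM : forall x y, `|cmul x y| <= `|x| * `|y|;
  cstar_norm : forall x, `|cmul (star x) x| = `|x| ^+ 2
}.

#[short(type="cstarAlgType")]
HB.structure Definition CStarAlgebra (R : realType) :=
  {A of CompleteNormedModule R[i] A & isCStarAlgebra R A}.

Arguments cmul {R s}.
Arguments cone {R s}.

Notation "x ** y" := (cmul x y) (at level 40, left associativity) : ring_scope.

(* The inner product is linear in its first argument. *)
HB.mixin Record isHilbert (R : realType) H
    of CompleteNormedModule R[i] H := {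
  inner : {dot H for (@Num.conj R[i])};
  normr_inner : forall x : H, `|x| ^+ 2 = inner x x
}.

#[short(type="hilbertType")]
HB.structure Definition Hilbert (R : realType) :=
  {H of CompleteNormedModule R[i] H & isHilbert R H}.

Arguments inner {R s}.

Notation "⟨ x , y ⟩" := (inner x y)
  (at level 0, x at level 99, y at level 99, format "⟨ x ,  y ⟩") : ring_scope.

Section General.
Context {R : realType}.
Local Notation C := R[i].

Definition lspan {V : lmodType C} (S : set V) : set V :=
  [set v | exists2 s : seq (C * V), (forall p, p \in s -> S p.2) &
                                    v = \sum_(p <- s) p.1 *: p.2].

(* [is_opnorm f M] : f is bounded with operator norm M. *)
Definition is_opnorm {V W : normedZmodType C} (f : V -> W) (M : C) : Prop :=
  [/\ 0 <= M, forall v, `|f v| <= M * `|v| &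
      forall M', 0 <= M' -> (forall v, `|f v| <= M' * `|v|) -> M <= M'].

Definition is_star_isomorphism {A B : cstarAlgType R} (f : A -> B) : Prop :=
  [/\ linear f, forall x y, f (x ** y) = f x ** f y,
      forall x, f (star x) = star (f x) & bijective f].

Definition is_state {A : cstarAlgType R} (omega : A -> C) : Prop :=
  [/\ scalar omega, forall x, 0 <= omega (star x ** x) & is_opnorm omega 1].

(** * Representations *)

(* A *-representation [x |-> pi x] into the bounded operators of H. *)
Definition is_rep {A : cstarAlgType R} {H : hilbertType R}
    (pi : A -> H -> H) : Prop :=
  [/\ forall x, linear (pi x) /\ continuous (pi x),
      forall xi, linear (pi ^~ xi),
      forall x y xi, pi (x ** y) xi = pi x (pi y xi) &
      forall x xi eta, ⟨pi (star x) xi, eta⟩ = ⟨xi, pi x eta⟩].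

Definition faithful {A : cstarAlgType R} {H : hilbertType R}
  (pi : A -> H -> H) : Prop := injective pi.

(* [pi] on [H] with cyclic vector [Omega] is a GNS triple of [omega]; such a
   triple is unique up to unitary equivalence. *)
Definition is_gns {A : cstarAlgType R} (omega : A -> C) {H : hilbertType R}
    (pi : A -> H -> H) (Omega : H) : Prop :=
  [/\ is_rep pi, dense (range (pi ^~ Omega)) &
      forall x, omega x = ⟨pi x Omega, Omega⟩].

Definition unitarily_equivalent {A : cstarAlgType R} {H H' : hilbertType R}
    (pi : A -> H -> H) (pi' : A -> H' -> H') : Prop :=
  exists U : H -> H', [/\ linear U, bijective U,
    forall xi eta, ⟨U xi, U eta⟩ = ⟨xi, eta⟩ &
    forall x xi, U (pi x xi) = pi' x (U xi)].

(** * Tensor products *)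

(* Via [t], [K] is the Hilbert space tensor product of [H1] and [H2]. *)
Definition is_hilbert_tensor {H1 H2 K : hilbertType R}
    (t : {bilinear H1 -> H2 -> K}) : Prop :=
  (forall x y x' y', ⟨t x y, t x' y'⟩ = ⟨x, x'⟩ * ⟨y, y'⟩) /\
  dense (lspan [set t x y | x in [set: H1] & y in [set: H2]]).

(* Via [tau], [D] is the minimal C*-tensor product of [A] and [B]: the image of
   the algebraic tensor product is a dense *-subalgebra, and the norm is the
   spatial one, i.e. the norm of operators on [K] = [H1] (x) [H2] for faithful
   representations of [A] on [H1] and of [B] on [H2] (it does not depend on the
   choice of these). *)
Definition is_min_tensor {A B D : cstarAlgType R}
    (tau : {bilinear A -> B -> D}) : Prop :=
  [/\ forall x y x' y', tau x y ** tau x' y' = tau (x ** x') (y ** y'),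
      forall x y, star (tau x y) = tau (star x) (star y),
      dense (lspan [set tau x y | x in [set: A] & y in [set: B]]) &
      exists (H1 H2 K : hilbertType R) (t : {bilinear H1 -> H2 -> K})
             (pi1 : A -> H1 -> H1) (pi2 : B -> H2 -> H2) (Pi : D -> K -> K),
        [/\ is_hilbert_tensor t, is_rep pi1 /\ faithful pi1,
            is_rep pi2 /\ faithful pi2,
            is_rep Pi /\ (forall x y xi eta,
              Pi (tau x y) (t xi eta) = t (pi1 x xi) (pi2 y eta)) &
            forall u, is_opnorm (Pi u) `|u|]].

(* [Pi] is the representation pi1 (x) pi2 of [D] = [A] (x) [B] on
   [K] = [H1] (x) [H2]. *)
Definition is_tensor_rep {A B D : cstarAlgType R} (tau : A -> B -> D)
    {H1 H2 K : hilbertType R} (t : H1 -> H2 -> K)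
    (pi1 : A -> H1 -> H1) (pi2 : B -> H2 -> H2) (Pi : D -> K -> K) : Prop :=
  is_rep Pi /\ forall x y xi eta,
    Pi (tau x y) (t xi eta) = t (pi1 x xi) (pi2 y eta).

(* [sigma] is the state rho1 (x) rho2 of [D] = [A] (x) [B]. *)
Definition is_tensor_state {A B D : cstarAlgType R} (tau : A -> B -> D)
    (rho1 : A -> C) (rho2 : B -> C) (sigma : D -> C) : Prop :=
  is_state sigma /\ forall x y, sigma (tau x y) = rho1 x * rho2 y.

(** * The algebras A(a) *)

(* Sequences are indexed from 0. *)
Definition seqmul (a b : nat -> nat) : nat -> nat := fun i => (a i * b i)%N.

Fixpoint tens_dim (a : nat -> nat) (n : nat) : nat :=
  if n is n'.+1 then (tens_dim a n' * a n')%N else 1%N.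

(* The matrix X_0 (x) ... (x) X_(n-1) of the algebra A_n(a) = 'M[C]_(tens_dim a n);
   tensors of matrices are Kronecker products [A *t B]. *)
Fixpoint mxtens_seq (a : nat -> nat) (X : forall i, 'M[C]_(a i)) (n : nat) :
    'M[C]_(tens_dim a n) :=
  if n is n'.+1 then mxtens_seq X n' *t X n' else 1%:M.

Definition mxunit_seq (a : nat -> nat) (j k : forall i, 'I_(a i)) (n : nat) :
    'M[C]_(tens_dim a n) :=
  mxtens_seq (fun i => delta_mx (j i) (k i)) n.

Definition adjmx {n} (X : 'M[C]_n) : 'M[C]_n := map_mx Num.conj X^T.

(* [A] is the C*-inductive limit of the algebras A_n(a) along X |-> X (x) I,
   with canonical embeddings [iota n]. *)
Definition is_uhf (a : nat -> nat) {A : cstarAlgType R}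
    (iota : forall n, 'M[C]_(tens_dim a n) -> A) : Prop :=
  [/\ forall n, [/\ linear (iota n), iota n 1%:M = cone,
        forall X Y, iota n (X *m Y) = iota n X ** iota n Y &
        forall X, iota n (adjmx X) = star (iota n X)],
      forall n, injective (iota n),
      forall n (X : 'M[C]_(tens_dim a n)),
        iota n.+1 (X *t (1%:M : 'M[C]_(a n))) = iota n X &
      dense (\bigcup_n range (iota n))].

(* [phi] is the isomorphism phi_(a,b) : A(a b) -> A(a) (x) A(b). *)
Definition is_phi (a b : nat -> nat) {A B AB D : cstarAlgType R}
    (iotaA : forall n, 'M[C]_(tens_dim a n) -> A)
    (iotaB : forall n, 'M[C]_(tens_dim b n) -> B)
    (iotaAB : forall n, 'M[C]_(tens_dim (seqmul a b) n) -> AB)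
    (tau : A -> B -> D) (phi : AB -> D) : Prop :=
  is_star_isomorphism phi /\
  (* 0-based, [mxtens_unindex j] is (j', j'') with j = j' * b i + j'' *)
  forall n (j k : forall i, 'I_(a i * b i)),
    phi (iotaAB n (mxunit_seq (a := seqmul a b) j k n)) =
    tau (iotaA n (mxunit_seq (fun i => (mxtens_unindex (j i)).1)
                             (fun i => (mxtens_unindex (k i)).1) n))
        (iotaB n (mxunit_seq (fun i => (mxtens_unindex (j i)).2)
                             (fun i => (mxtens_unindex (k i)).2) n)).

(** * Product states *)

(* Positivity in the C*-algebra M_n. *)
Definition mx_positive {n} (X : 'M[C]_n) : Prop :=
  exists Y : 'M[C]_n, X = adjmx Y *m Y.

Definition in_T (a : nat -> nat) (T : forall n, 'M[C]_(a n)) : Prop :=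
  forall n, mx_positive (T n) /\ \tr (T n) = 1.

Definition kron_seq (a b : nat -> nat) (T : forall n, 'M[C]_(a n))
    (S : forall n, 'M[C]_(b n)) : forall n, 'M[C]_(seqmul a b n) :=
  fun n => T n *t S n.

(* [omega] is the product state omega_T of [A] = A(a). *)
Definition is_product_state (a : nat -> nat) {A : cstarAlgType R}
    (iota : forall n, 'M[C]_(tens_dim a n) -> A) (T : forall n, 'M[C]_(a n))
    (omega : A -> C) : Prop :=
  is_state omega /\ forall n (j k : forall i, 'I_(a i)),
    omega (iota n (mxunit_seq j k n)) = \prod_(i < n) T i (k i) (j i).

End General.

(* Main.v *)
Require Import Defs.
From HB Require Import structures.
From mathcomp Require Import all_boot all_order all_algebra.
From mathcomp Require Import sesquilinear complex mxtens.
From mathcomp Require Import ring.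
From mathcomp Require Import boolp classical_sets reals topology normedtype.
Import numFieldNormedType.Exports.
Local Open Scope ring_scope.

(** Both parts rest on one principle: a positive functional on A(c) is
    determined by its values on the matrix units of the algebras A_n(c)
    ([product_state_unique]). Matrix units span a dense subspace, so what is
    needed is that positive functionals are bounded
    ([positive_functional_bounded]). This is proved directly: if h is
    self-adjoint and small, then 1 - h is the square of a self-adjoint element
    ([sqrt_one_sub], by a fixed-point argument), hence f h <= f 1.

    For (i), the pullback of omega_T (x) omega_S along phi is positive, because
    phi is multiplicative and *-preserving. On the matrix units it takes the
    value of omega_T times that of omega_S, which is the product of the entries
    of the Kronecker products T_n (x) S_n ([prod_kron]).

    For (ii), consider the representation (pi_T (x) pi_S) o phi and the vector
    Om_T (x) Om_S. The corresponding vector functional is positive and has the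
    same values on the matrix units, so it is the product state of T (x) S. The
    vector is cyclic: phi is onto, so the range contains all
    pi_T(x) Om_T (x) pi_S(y) Om_S, and these span a dense subspace
    ([tensor_range_dense]). Uniqueness of the GNS representation
    ([gns_unique]) concludes. *)

Set Implicit Arguments.
Unset Strict Implicit.
Unset Printing Implicit Defensive.
Import Order.TTheory GRing.Theory Num.Theory.
Local Open Scope classical_set_scope.

(** * Approximation in complex normed modules *)

Section Approximation.
Context {R : realType}.
Local Notation C := R[i].

(** A positive element of R[i] is a positive real number, so that the
    archimedean property of R applies. *)
Lemma half_exp_small (e : C) :
  0 < e -> exists N, forall n, (N <= n)%N -> 2^-1 ^+ n < e.
Proof.
case: e => r s; rewrite ltcE /= => /andP[/eqP s0 r0].
exists (Num.bound r^-1) => n leNn.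
have -> : (2^-1 ^+ n : C) = ((2^-1 ^+ n : R)%:C)%C.
  by rewrite rmorphXn /= fmorphV /= rmorph_nat.
rewrite ltcE /= s0 eqxx /= exprVn invf_plt ?posrE ?exprn_gt0 //.
apply: (lt_le_trans (archi_boundP _)); first by rewrite invr_ge0 ltW.
by rewrite -natrX ler_nat (leq_trans leNn) // ltnW // ltn_expl.
Qed.

Lemma norm_small_eq0 (V : normedZmodType C) (v : V) :
  (forall e : C, 0 < e -> `|v| < e) -> v = 0.
Proof.
move=> small; apply/eqP; rewrite -normr_eq0; apply/negP => /negP v0.
by have := small `|v|; rewrite normr_gt0 -normr_eq0 ltxx => /(_ v0).
Qed.

Lemma cauchy_seq_cvg (V : completeNormedModType C) (u : nat -> V) :
  (forall e : C, 0 < e ->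
     exists N, forall n, (N <= n)%N -> `|u N - u n| < e) ->
  exists l : V, u n @[n --> \oo] --> l.
Proof.
move=> uC; apply/cvg_ex; apply: (@cauchy_cvg V (u @ \oo)).
apply/cauchyP => e /uC[N hN].
exists (u N); exists N => // n /= Nn; rewrite -ball_normE /=; exact: hN.
Qed.

Lemma closure_normP (V : normedModType C) (S : set V) (v : V) :
  closure S v <-> forall e : C, 0 < e -> exists2 s, S s & `|v - s| < e.
Proof.
split=> [Sv e e0|Sv B /nbhs_ballP[e /= e0 eB]].
  have [s [Ss vs]] := Sv _ (nbhsx_ballx v e e0).
  by exists s => //; move: vs; rewrite -ball_normE.
have [s Ss vs] := Sv e e0; exists s; split=> //.
by apply: eB; rewrite -ball_normE.
Qed.

Lemma dense_closureP (T : topologicalType) (S : set T) :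
  dense S <-> forall x, closure S x.
Proof.
split=> [dS x B|Scl O [x Ox] oO].
  rewrite nbhsE => -[O [oO Ox] OB].
  have [y [Oy Sy]] := dS O (ex_intro _ x Ox) oO.
  by exists y; split=> //; apply: OB.
have [y [Sy Oy]] := Scl x O (open_nbhs_nbhs (conj oO Ox)).
by exists y.
Qed.

Lemma linear_closure (V : normedModType C) (S : set V) :
  (forall (c : C) v w, S v -> S w -> S (c *: v + w)) ->
  forall (c : C) v w, closure S v -> closure S w -> closure S (c *: v + w).
Proof.
move=> Slin c v w /closure_normP vS /closure_normP wS.
apply/closure_normP => e e0.
have c0 : 0 < `|c| + 1 by rewrite ltr_wpDl.
have d0 : 0 < e / (`|c| + 1) by rewrite divr_gt0.
have [s Ss vs] := vS _ d0; have [r Sr wr] := wS _ d0.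
exists (c *: s + r); first exact: Slin.
have -> : c *: v + w - (c *: s + r) = c *: (v - s) + (w - r).
  by rewrite scalerBr opprD addrACA.
rewrite (le_lt_trans (ler_normD _ _)) // normrZ.
rewrite (@le_lt_trans _ _ (`|c| * (e / (`|c| + 1)) + `|w - r|)) //.
  by rewrite lerD2r ler_wpM2l // ltW.
rewrite (@lt_le_trans _ _ (`|c| * (e / (`|c| + 1)) + e / (`|c| + 1))) //.
  by rewrite ltrD2l.
by rewrite -[X in _ + X]mul1r -mulrDl mulrC divfK // gt_eqF.
Qed.


End Approximation.

(** * Positive functionals on C*-algebras *)

Section CStarAlgebra.
Context {R : realType} {A : cstarAlgType R}.
Local Notation C := R[i].

Lemma star1 : star cone = cone :> A.
Proof. by rewrite -[LHS]cmul1l -{1}[cone]starK -starM cmul1l starK. Qed.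

Lemma starN (x : A) : star (- x) = - star x.
Proof. by rewrite -scaleN1r starZ rmorphN rmorph1 scaleN1r. Qed.

Lemma starB (x y : A) : star (x - y) = star x - star y.
Proof. by rewrite starD starN. Qed.

Lemma norm_star_ge (x : A) : `|x| <= `|star x|.
Proof.
have [->|x0] := eqVneq x 0; first by rewrite normr0.
rewrite -(@ler_pM2r _ `|x|) ?normr_gt0 // -expr2 -cstar_norm.
exact: cnormM.
Qed.

Lemma norm_star (x : A) : `|star x| = `|x|.
Proof.
by apply/le_anti; rewrite norm_star_ge andbC -{2}[x]starK norm_star_ge.
Qed.

(** Completing the square, 1 - h = (1 - z)^2 means z = (h + z^2) / 2. For
    |h| <= 3/4 the right-hand side maps the ball of radius 1/2 into itself and
    is there a contraction of ratio 1/2. Its iterates from 0 converge to a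
    fixed point z, the only one in that ball; star z is another one, hence
    equals z. This replaces the functional calculus. *)
Lemma sqrt_one_sub (h : A) : star h = h -> `|h| <= 3 / 4 ->
  exists2 y : A, star y = y & y ** y = cone - h.
Proof.
move=> hh h34.
pose F (z : A) := (2^-1 : C) *: (h + z ** z).
have half : `|2^-1 : C| = 2^-1 by rewrite ger0_norm // invr_ge0 ler0n.
have F_ball z : `|z| <= 2^-1 -> `|F z| <= 2^-1.
  move=> z2; rewrite normrZ half ler_piMr ?invr_ge0 ?ler0n //.
  rewrite (le_trans (ler_normD _ _)) //.
  have -> : (1 : C) = 3 / 4 + 2^-1 * 2^-1 by field.
  by rewrite lerD // (le_trans (cnormM _ _)) // ler_pM.
have F_lip z w : `|z| <= 2^-1 -> `|w| <= 2^-1 ->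
    `|F z - F w| <= 2^-1 * `|z - w|.
  move=> z2 w2; rewrite -scalerBr normrZ half ler_pM2l ?invr_gt0 ?ltr0n //.
  have -> : h + z ** z - (h + w ** w) = z ** (z - w) + (z - w) ** w.
    rewrite linearBr linearBl /= addrA subrK opprD addrACA subrr add0r //.
  rewrite (le_trans (ler_normD _ _)) //.
  have -> : `|z - w| = 2^-1 * `|z - w| + `|z - w| * 2^-1 by field.
  apply: lerD; rewrite (le_trans (cnormM _ _)) //.
    by rewrite ler_wpM2r.
  by rewrite ler_wpM2l.
pose u n := iter n F 0.
have u_ball n : `|u n| <= 2^-1.
  by elim: n => [|n /F_ball//]; rewrite normr0 invr_ge0 ler0n.
have u_dist n m : `|u n - u (n + m)%N| <= 2^-1 ^+ n.
  elim: n => [|n IHn] /=.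
    rewrite add0n sub0r normrN expr0 (le_trans (u_ball _)) //.
    by rewrite invf_le1 ?ler1n ?ltr0n.
  rewrite (le_trans (F_lip _ _ (u_ball _) (u_ball _))) // exprS.
  by rewrite ler_pM2l // invr_gt0 ltr0n.
have [z uz] : exists z : A, u n @[n --> \oo] --> z.
  apply: cauchy_seq_cvg => e /half_exp_small[N hN]; exists N => n leNn.
  by rewrite -(subnKC leNn) (le_lt_trans (u_dist _ _)) // hN.
have near_u (e : C) : 0 < e -> exists n, `|z - u n| < e /\ `|z - u n.+1| < e.
  move=> e0; have /cvgrPdist_lt/(_ e e0)[N _ hN] := uz.
  by exists N; split; apply: hN => /=.
have z_ball : `|z| <= 2^-1.
  rewrite real_leNgt ?realE ?normr_ge0 ?invr_ge0 ?ler0n //; apply/negP.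
  rewrite -subr_gt0 => /near_u[n [+ _]]; rewrite ltrBrDr.
  suff zle : `|z| <= `|z - u n| + 2^-1 by move/(le_lt_trans zle); rewrite ltxx.
  by rewrite -{1}[z](subrK (u n)) (le_trans (ler_normD _ _)) // lerD2l.
have zF : z = F z.
  apply/eqP; rewrite -subr_eq0; apply/eqP; apply: norm_small_eq0 => e e0.
  have [n [zu zu']] := near_u (e / 2) (divr_gt0 e0 (ltr0Sn _ 1)).
  rewrite -[z - F z](subrKA (u n.+1)) (le_lt_trans (ler_normD _ _)) //.
  rewrite [e]splitr ltrD // distrC.
  rewrite (le_lt_trans (F_lip _ _ z_ball (u_ball n))) //.
  by rewrite (le_lt_trans _ zu) // ler_piMl // invf_le1 ?ler1n ?ltr0n.
have z_sa : star z = z.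
  have Fz : star z = F (star z).
    by rewrite {1}zF starZ starD starM hh fmorphV /= rmorph_nat.
  apply/eqP; rewrite -subr_eq0 -normr_le0.
  have := F_lip (star z) z; rewrite -Fz -zF norm_star => /(_ z_ball z_ball).
  rewrite -subr_ge0.
  have -> : 2^-1 * `|star z - z| - `|star z - z| = - (2^-1 * `|star z - z|).
    by field.
  by rewrite oppr_ge0 pmulr_rle0 // invr_gt0 ltr0n.
exists (cone - z); first by rewrite starB star1 z_sa.
have zz : z ** z = z + z - h.
  suff -> : z + z = h + z ** z by rewrite addrAC subrr add0r.
  rewrite {1 2}zF /F -mulr2n -scaler_nat scalerA.
  by rewrite mulfV ?pnatr_eq0 // scale1r.
rewrite linearBr /= !linearBl /= !cmul1l cmul1r zz.
have -> : z - (z + z - h) = h - z.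
  by rewrite -addrA opprD addrA subrr sub0r opprB.
by rewrite opprB addrA subrK.
Qed.

(** For a self-adjoint h of norm at most 3/4, both 1 - h and 1 + h are squares
    of self-adjoint elements, which gives |f h| <= f 1. The general case follows
    by taking real and imaginary parts and rescaling. Boundedness is what makes
    the pullback of a state along a *-isomorphism continuous without knowing
    that the isomorphism is isometric. *)
Lemma positive_functional_bounded (f : {scalar A}) :
  (forall x, 0 <= f (star x ** x)) ->
  exists2 M : C, 0 <= M & forall x, `|f x| <= M * `|x|.
Proof.
move=> f_pos.
have f1 : 0 <= f cone by have := f_pos cone; rewrite star1 cmul1l.
have f_sub h : star h = h -> `|h| <= 3 / 4 -> 0 <= f cone - f h.
  move=> hh h34; have [y yy y2] := sqrt_one_sub hh h34.
  by rewrite -linearB /= -y2 -{1}yy.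
have f_sa h : star h = h -> `|h| <= 3 / 4 -> `|f h| <= f cone.
  move=> hh h34; have le1 := f_sub h hh h34.
  have le2 : 0 <= f cone + f h.
    have := f_sub (- h); rewrite linearN opprK /= starN hh normrN.
    exact.
  have fh_real : f h \is Num.real.
    by rewrite -[f h](subKr (f cone)) rpredB ?ger0_real.
  rewrite real_ler_norml //; apply/andP; split; last by rewrite -subr_ge0.
  by rewrite -subr_ge0 opprK addrC.
have f_ball x : `|x| <= 3 / 4 -> `|f x| <= f cone + f cone.
  move=> x34.
  (* the real and imaginary parts of x *)
  pose h := (2^-1 : C) *: (x + star x).
  pose k := (2^-1 : C) *: ('i *: (star x - x)).
  have half : `|2^-1 : C| = 2^-1 by rewrite ger0_norm // invr_ge0 ler0n.
  have xhk : x = h + 'i *: k.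
    rewrite /h /k !scalerA mulrAC -expr2 sqrCi mulN1r scaleNr -scalerN opprB.
    rewrite -scalerDr addrACA subrr addr0 scalerDr -scalerDl -[2^-1]mul1r.
    by rewrite -splitr scale1r.
  have h_sa : star h = h.
    by rewrite starZ starD starK addrC fmorphV /= rmorph_nat.
  have k_sa : star k = k.
    rewrite !starZ starB starK conjCi fmorphV /= rmorph_nat.
    by rewrite scaleNr -scalerN opprB.
  have h34 : `|h| <= 3 / 4.
    rewrite normrZ half ler_pdivrMl ?ltr0n // (le_trans (ler_normD _ _)) //.
    by rewrite norm_star (mulr_natl (3 / 4) 2) lerD.
  have k34 : `|k| <= 3 / 4.
    rewrite !normrZ half normCi mul1r ler_pdivrMl ?ltr0n //.
    rewrite (le_trans (ler_normB _ _)) //.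
    by rewrite norm_star (mulr_natl (3 / 4) 2) lerD.
  clearbody h k; rewrite xhk linearD linearZ /= (le_trans (ler_normD _ _)) //.
  by rewrite normrM normCi mul1r lerD // f_sa.
exists ((f cone + f cone) / (3 / 4)).
  by rewrite divr_ge0 ?addr_ge0 // divr_ge0.
move=> x; have [->|x0] := eqVneq x 0; first by rewrite linear0 !normr0 mulr0.
have nx0 : 0 < `|x| by rewrite normr_gt0.
have [c c0 cx] : exists2 c : C, 0 < c & c * `|x| = 3 / 4.
  by exists (3 / 4 / `|x|); [rewrite !divr_gt0 | rewrite divfK ?gt_eqF].
have := f_ball (c *: x); rewrite linearZ /= normrZ normrM (gtr0_norm c0) cx.
move=> /(_ (lexx _)); rewrite -ler_pdivlMl // => /le_trans; apply.
have -> : c = 3 / 4 / `|x| by rewrite -cx mulfK ?gt_eqF.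
by rewrite invf_div mulrC mulrA mulrAC.
Qed.

Lemma bounded_functionals_eq (f g : {scalar A}) (S : set A) :
  dense S -> (forall x, S x -> f x = g x) ->
  (exists2 M : C, 0 <= M & forall x, `|f x| <= M * `|x|) ->
  (exists2 M : C, 0 <= M & forall x, `|g x| <= M * `|x|) -> f =1 g.
Proof.
move=> dS fgS [M M0 fM] [N N0 gN] x.
apply/eqP; rewrite -subr_eq0; apply/eqP; apply: norm_small_eq0 => e e0.
have MN : 0 < M + N + 1 by rewrite ltr_wpDl // addr_ge0.
have /dense_closureP/(_ x)/closure_normP/(_ _ (divr_gt0 e0 MN))[s Ss xs] := dS.
have -> : f x - g x = f (x - s) - g (x - s).
  by rewrite !linearB /= (fgS s Ss) opprK [- g x + _]addrC addrA subrK.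
rewrite (le_lt_trans (ler_normB _ _)) // (le_lt_trans (lerD (fM _) (gN _))) //.
rewrite -mulrDl (@le_lt_trans _ _ ((M + N + 1) * `|x - s|)) //.
  by rewrite ler_wpM2r // lerDl.
by rewrite mulrC -ltr_pdivlMr.
Qed.

End CStarAlgebra.

(** * Matrix units and product states *)

Section MatrixUnits.
Context {R : realType}.
Local Notation C := R[i].

Lemma mxtens_seq_ext (c : nat -> nat) (X Y : forall i, 'M[C]_(c i)) n :
  (forall i, (i < n)%N -> X i = Y i) -> mxtens_seq X n = mxtens_seq Y n.
Proof.
elim: n => [//|n IHn] XY /=; rewrite IHn ?XY // => i lt_in.
by apply: XY; apply: ltnW.
Qed.

Lemma delta_tens m n (i j : 'I_m) (i' j' : 'I_n) :
  delta_mx (mxtens_index (i, i')) (mxtens_index (j, j')) =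
  delta_mx i j *t delta_mx i' j' :> 'M[C]_(m * n).
Proof.
apply/matrixP => u v.
case: (mxtens_indexP u) => p p'; case: (mxtens_indexP v) => q q'.
rewrite tensmxE !mxE !(can_eq (@mxtens_indexK m n)) !xpair_eqE.
by rewrite -natrM mulnb andbACA.
Qed.

(** An index of a matrix unit of A_n(c) is a tuple of n indices; the sequences j
    and k are completed arbitrarily from position n on. *)
Lemma delta_mxunit_seq (c : nat -> nat) (c0 : forall i, (0 < c i)%N) n
    (p q : 'I_(tens_dim c n)) :
  exists j k : forall i, 'I_(c i), delta_mx p q = mxunit_seq j k n :> 'M[C]__.
Proof.
elim: n p q => [|n IHn] u v.
  exists (fun i => Ordinal (c0 i)), (fun i => Ordinal (c0 i)).
  by apply/matrixP => i j; rewrite !mxE !ord1.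
case: (mxtens_indexP u) => p p'; case: (mxtens_indexP v) => q q'.
have [j [k jk]] := IHn p q.
exists (dfwith j p'), (dfwith k q').
rewrite delta_tens jk /mxunit_seq /= !dfwith_in; congr (_ *t _).
by apply: mxtens_seq_ext => i lt_in; rewrite !dfwith_out // neq_ltn lt_in orbT.
Qed.

Lemma uhf_positive_eq (c : nat -> nat) (c0 : forall i, (0 < c i)%N)
    (A : cstarAlgType R) (iota : forall n, 'M[C]_(tens_dim c n) -> A)
    (f g : {scalar A}) :
  is_uhf iota ->
  (forall x, 0 <= f (star x ** x)) -> (forall x, 0 <= g (star x ** x)) ->
  (forall n (j k : forall i, 'I_(c i)),
     f (iota n (mxunit_seq j k n)) = g (iota n (mxunit_seq j k n))) ->
  f =1 g.
Proof.
move=> [iota_morph _ _ iota_dense] f_pos g_pos fg.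
apply: (bounded_functionals_eq iota_dense); last 2 first.
- exact: positive_functional_bounded.
- exact: positive_functional_bounded.
move=> _ [n _ [X _ <-]].
have [iota_lin _ _ _] := iota_morph n.
pose i : {linear 'M[C]_(tens_dim c n) -> A} :=
  HB.pack (iota n) (GRing.isLinear.Build C _ A *:%R (iota n) iota_lin).
have -> : iota n = i by [].
rewrite [X]matrix_sum_delta !linear_sum; apply: eq_bigr => p _.
rewrite !linear_sum; apply: eq_bigr => q _; rewrite !linearZ /=; congr (_ * _).
have [j [k ->]] := delta_mxunit_seq c0 p q; exact: fg.
Qed.

Lemma product_state_unique (c : nat -> nat) (c0 : forall i, (0 < c i)%N)
    (A : cstarAlgType R) (iota : forall n, 'M[C]_(tens_dim c n) -> A)
    (T : forall n, 'M[C]_(c n)) (omega f : A -> C) :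
  is_uhf iota -> is_product_state iota T omega ->
  scalar f -> (forall x, 0 <= f (star x ** x)) ->
  (forall n (j k : forall i, 'I_(c i)),
     f (iota n (mxunit_seq j k n)) = \prod_(i < n) T i (k i) (j i)) ->
  f = omega.
Proof.
move=> uhf [[omega_lin omega_pos _] omegaT] f_lin f_pos fT.
pose g : {scalar A} :=
  HB.pack omega (GRing.isLinear.Build C _ C *%R omega omega_lin).
pose h : {scalar A} :=
  HB.pack f (GRing.isLinear.Build C _ C *%R f f_lin).
apply/funext; apply: (uhf_positive_eq c0 (f := h) (g := g) uhf) => // n j k.
by rewrite /= fT omegaT.
Qed.

Lemma in_T_kron (a b : nat -> nat) (T : forall n, 'M[C]_(a n))
    (S : forall n, 'M[C]_(b n)) :
  in_T T -> in_T S -> in_T (kron_seq T S).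
Proof.
move=> hT hS n; have [[Y TY] trT] := hT n; have [[Z SZ] trS] := hS n.
split.
  exists (Y *t Z).
  by rewrite /kron_seq TY SZ -tensmx_mul /adjmx trmx_tens map_mxT.
rewrite -[RHS]mulr1 -{1}trT -trS /mxtrace mulr_sum.
by apply: eq_bigr => i _; rewrite mxE.
Qed.

Lemma prod_kron (a b : nat -> nat) (T : forall n, 'M[C]_(a n))
    (S : forall n, 'M[C]_(b n)) n (j k : forall i, 'I_(a i * b i)) :
  (\prod_(i < n) T i (mxtens_unindex (k i)).1 (mxtens_unindex (j i)).1) *
  (\prod_(i < n) S i (mxtens_unindex (k i)).2 (mxtens_unindex (j i)).2) =
  \prod_(i < n) kron_seq T S i (k i) (j i).
Proof. by rewrite -big_split; apply: eq_bigr => i _; rewrite mxE. Qed.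


End MatrixUnits.

(** * Hilbert spaces and their tensor products *)

Section Hilbert.
Context {R : realType}.
Local Notation C := R[i].

(** The defect d of inner products is sesquilinear and vanishes on the diagonal.
    Expanding at z + w makes d antisymmetric; at x and 'i y this also makes it
    symmetric, so that it vanishes. *)
Lemma isometry_inner (H H' : hilbertType R) (U : {linear H -> H'}) :
  (forall x, `|U x| = `|x|) -> forall x y, ⟨U x, U y⟩ = ⟨x, y⟩.
Proof.
move=> normU x y.
have Usq z : ⟨U z, U z⟩ = ⟨z, z⟩ by rewrite -!normr_inner normU.
pose d z w := ⟨U z, U w⟩ - ⟨z, w⟩.
have d_anti z w : d z w + d w z = 0.
  have := Usq (z + w); rewrite linearD /= !linearDl !linearDr /= !Usq.
  by move/eqP; rewrite -subr_eq0 => /eqP <-; rewrite /d; ring.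
have d_ir : d x ('i *: y) = - 'i * d x y.
  by rewrite /d linearZ /= !linearZr_LR /= conjCi -mulrBr.
have d_il : d ('i *: y) x = 'i * d y x.
  by rewrite /d linearZ /= !linearZl_LR /= -mulrBr.
have d_sym : d x y = d y x.
  apply: (mulfI (neq0Ci _)); apply/eqP; rewrite -subr_eq0 -oppr_eq0 opprB.
  by rewrite addrC -mulNr -d_ir -d_il d_anti.
have := d_anti x y; rewrite -d_sym -mulr2n => /eqP.
by rewrite mulrn_eq0 /= subr_eq0 => /eqP.
Qed.

Lemma norm_hilbert_tensor (H1 H2 K : hilbertType R)
    (t : {bilinear H1 -> H2 -> K}) :
  is_hilbert_tensor t -> forall x y, `|t x y| = `|x| * `|y|.
Proof.
move=> [t_inner _] x y; apply/eqP.
by rewrite -(@eqrXn2 _ 2) ?mulr_ge0 // exprMn !normr_inner t_inner.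
Qed.

(** As |t x y| = |x| |y|, the map t is separately continuous. Approximating the
    second variable and then the first puts every t x y in the closure of S,
    which is a subspace. *)
Lemma tensor_range_dense (H1 H2 K : hilbertType R)
    (t : {bilinear H1 -> H2 -> K}) (S : set K) (S1 : set H1) (S2 : set H2) :
  is_hilbert_tensor t -> dense S1 -> dense S2 ->
  S 0 -> (forall (c : C) v w, S v -> S w -> S (c *: v + w)) ->
  (forall x y, S1 x -> S2 y -> S (t x y)) -> dense S.
Proof.
move=> ht /dense_closureP dS1 /dense_closureP dS2 S0 Slin St.
have norm_t := norm_hilbert_tensor ht.
have [_ /dense_closureP dt] := ht.
have St1 x y : S1 x -> closure S (t x y).
  move=> S1x; apply/closure_normP => e e0.
  have x0 : 0 < `|x| + 1 by rewrite ltr_wpDl.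
  have /closure_normP/(_ _ (divr_gt0 e0 x0))[y' S2y' yy'] := dS2 y.
  exists (t x y'); first exact: St.
  rewrite -linearBr norm_t (@le_lt_trans _ _ ((`|x| + 1) * `|y - y'|)) //.
    by rewrite ler_wpM2r // lerDl.
  by rewrite mulrC -ltr_pdivlMr.
have Stt x y : closure S (t x y).
  apply: closed_closure; apply/closure_normP => e e0.
  have y0 : 0 < `|y| + 1 by rewrite ltr_wpDl.
  have /closure_normP/(_ _ (divr_gt0 e0 y0))[x' S1x' xx'] := dS1 x.
  exists (t x' y); first exact: St1.
  rewrite -linearBl norm_t (@le_lt_trans _ _ (`|x - x'| * (`|y| + 1))) //.
    by rewrite ler_wpM2l // lerDl.
  by rewrite -ltr_pdivlMr.
apply/dense_closureP => v; apply: closed_closure.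
apply: closureS (dt v) => _ [s s_t ->].
elim: s s_t => [|p s IHs] s_t.
  by rewrite big_nil; apply: subset_closure.
rewrite big_cons; apply: linear_closure => //; last first.
  by apply: IHs => q qs; apply: s_t; rewrite inE qs orbT.
have [x _ [y _ <-]] := s_t p (mem_head _ _); exact: Stt.
Qed.

End Hilbert.

(** * Uniqueness of the GNS representation *)

Section GNS.
Context {R : realType} {A : cstarAlgType R}.
Local Notation C := R[i].

(** The closure of the correspondence pi x Om <-> pi' x Om'. For two GNS triples
    of one functional it is the graph of the intertwining unitary; working with
    the graph treats the two representations symmetrically and spares a separate
    construction of the inverse. *)
Definition gns_graph {H H' : hilbertType R} (pi : A -> H -> H) (Om : H)
    (pi' : A -> H' -> H') (Om' : H') (xi : H) (eta : H') : Prop :=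
  exists x : nat -> A, pi (x n) Om @[n --> \oo] --> xi /\
                       pi' (x n) Om' @[n --> \oo] --> eta.

Lemma gns_graph_sym {H H' : hilbertType R} (pi : A -> H -> H) (Om : H)
    (pi' : A -> H' -> H') (Om' : H') xi eta :
  gns_graph pi Om pi' Om' xi eta -> gns_graph pi' Om' pi Om eta xi.
Proof. by move=> [x [xi_x eta_x]]; exists x. Qed.

Lemma gns_norm (omega : A -> C) {H : hilbertType R} (pi : A -> H -> H)
    (Om : H) x :
  is_gns omega pi Om -> `|pi x Om| ^+ 2 = omega (star x ** x).
Proof.
by move=> [[_ _ piM piS] _ ->]; rewrite normr_inner piM piS.
Qed.

Section Graph.
Context (omega : A -> C) (H H' : hilbertType R).
Context (pi : A -> H -> H) (Om : H) (pi' : A -> H' -> H') (Om' : H').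
Context (gns : is_gns omega pi Om) (gns' : is_gns omega pi' Om').

Let graph := gns_graph pi Om pi' Om'.

Lemma gns_norm_eq x : `|pi x Om| = `|pi' x Om'|.
Proof.
by apply/eqP; rewrite -(@eqrXn2 _ 2) // (gns_norm x gns) (gns_norm x gns').
Qed.

(** Choose x_n with pi (x_n) Om within 2^-n of xi. Since pi x Om and pi' x Om'
    have the same norm, the sequence pi' (x_n) Om' is Cauchy too. *)
Lemma gns_graph_total xi : exists eta, graph xi eta.
Proof.
have [[_ pi_lin _ _] /dense_closureP pi_dense _] := gns.
have [[_ pi'_lin _ _] _ _] := gns'.
have /choice[x xi_x] : forall n, exists x, `|xi - pi x Om| < 2^-1 ^+ n.
  move=> n; have e0 : 0 < (2^-1 : C) ^+ n by rewrite exprn_gt0 // invr_gt0.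
  by have /closure_normP/(_ _ e0)[_ [x _ <-]] := pi_dense xi; exists x.
have [eta eta_x] : exists eta : H', pi' (x n) Om' @[n --> \oo] --> eta.
  apply: cauchy_seq_cvg => e e0.
  have [N hN] := half_exp_small (divr_gt0 e0 (ltr0Sn _ 1)).
  exists N => n leNn.
  have -> : pi' (x N) Om' - pi' (x n) Om' = pi' (x N - x n) Om'.
    by rewrite (zmod_morphism_linear (pi'_lin Om')).
  rewrite -gns_norm_eq (zmod_morphism_linear (pi_lin Om)).
  rewrite -[_ - _](subrKA xi) (le_lt_trans (ler_normD _ _)) //.
  rewrite [e]splitr ltrD //.
    by rewrite distrC (lt_trans (xi_x N)) // hN.
  by rewrite (lt_trans (xi_x n)) // hN.
exists eta, x; split=> //.
apply/cvgrPdist_lt => e /half_exp_small[N hN].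
by exists N => // n /hN; apply: lt_trans.
Qed.

Lemma gns_graph_linear (c : C) xi eta xi' eta' :
  graph xi eta -> graph xi' eta' -> graph (c *: xi + xi') (c *: eta + eta').
Proof.
have [[_ pi_lin _ _] _ _] := gns.
have [[_ pi'_lin _ _] _ _] := gns'.
move=> [x [xi_x eta_x]] [y [xi_y eta_y]].
exists (fun n => c *: x n + y n); split.
  under eq_fun do rewrite pi_lin.
  by apply: cvgD => //; apply: cvgZr.
under eq_fun do rewrite pi'_lin.
by apply: cvgD => //; apply: cvgZr.
Qed.

Lemma gns_graph_norm xi eta : graph xi eta -> `|eta| = `|xi|.
Proof.
move=> [x [xi_x eta_x]].
have norm_xi := cvg_norm (FF := eventually_filter) xi_x.
have := cvg_norm (FF := eventually_filter) eta_x.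
under eq_fun do rewrite -gns_norm_eq.
by move/(cvg_unique (@norm_hausdorff C C^o)) => /(_ _ norm_xi).
Qed.

Lemma gns_graph_rep y xi eta : graph xi eta -> graph (pi y xi) (pi' y eta).
Proof.
have [[pi_cont _ piM _] _ _] := gns.
have [[pi'_cont _ pi'M _] _ _] := gns'.
move=> [x [xi_x eta_x]].
exists (fun n => y ** x n); split.
  under eq_fun do rewrite piM.
  by apply: cvg_comp xi_x _; apply: (pi_cont y).2.
under eq_fun do rewrite pi'M.
by apply: cvg_comp eta_x _; apply: (pi'_cont y).2.
Qed.

(** By linearity (0, eta - eta') lies in the graph, along which norms agree. *)
Lemma gns_graph_fun xi eta eta' : graph xi eta -> graph xi eta' -> eta = eta'.
Proof.
move=> xi_eta xi_eta'; apply/eqP; rewrite -subr_eq0 -normr_eq0.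
have := gns_graph_linear (-1) xi_eta' xi_eta.
rewrite !scaleN1r ![- _ + _]addrC subrr => /gns_graph_norm ->.
by rewrite normr0.
Qed.

End Graph.

Lemma gns_unique (omega : A -> C) (H H' : hilbertType R)
    (pi : A -> H -> H) (Om : H) (pi' : A -> H' -> H') (Om' : H') :
  is_gns omega pi Om -> is_gns omega pi' Om' -> unitarily_equivalent pi pi'.
Proof.
move=> gns gns'.
have [U UG] := choice (gns_graph_total gns gns').
have [V VG] := choice (gns_graph_total gns' gns).
have U_lin : linear U.
  move=> c xi eta; apply: (gns_graph_fun gns gns' (UG _)).
  exact: (gns_graph_linear gns gns').
pose Ul : {linear H -> H'} :=
  HB.pack U (GRing.isLinear.Build C _ _ *:%R U U_lin).
exists U; split=> //.
- exists V => [xi|eta].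
    exact: (gns_graph_fun gns' gns (VG _) (gns_graph_sym (UG _))).
  exact: (gns_graph_fun gns gns' (UG _) (gns_graph_sym (VG _))).
- apply: (@isometry_inner _ _ _ Ul) => xi; exact: (gns_graph_norm gns gns').
- move=> x xi; apply: (gns_graph_fun gns gns' (UG _)).
  exact: (gns_graph_rep gns gns').
Qed.

End GNS.

(** * Tensor products of product states and of their GNS representations *)

Theorem theorem3p4 (R : realType)
  (a b : nat -> nat)
  (ha : forall n, (2 <= a n)%N) (hb : forall n, (2 <= b n)%N)
  (A B AB : cstarAlgType R)
  (iotaA : forall n, 'M[R[i]]_(tens_dim a n) -> A)
  (iotaB : forall n, 'M[R[i]]_(tens_dim b n) -> B)
  (iotaAB : forall n, 'M[R[i]]_(tens_dim (seqmul a b) n) -> AB)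
  (hA : is_uhf iotaA) (hB : is_uhf iotaB) (hAB : is_uhf iotaAB)
  (D : cstarAlgType R) (tau : {bilinear A -> B -> D}) (hD : is_min_tensor tau)
  (phi : AB -> D) (hphi : is_phi iotaA iotaB iotaAB tau phi) :
  (forall (T : forall n, 'M[R[i]]_(a n)) (S : forall n, 'M[R[i]]_(b n)),
     in_T T -> in_T S ->
     in_T (kron_seq T S) /\
     forall (omegaT : A -> R[i]) (omegaS : B -> R[i]) (omegaTS : AB -> R[i])
            (sigma : D -> R[i]),
       is_product_state iotaA T omegaT ->
       is_product_state iotaB S omegaS ->
       is_product_state iotaAB (kron_seq T S) omegaTS ->
       is_tensor_state tau omegaT omegaS sigma ->
       sigma \o phi = omegaTS)
  /\
  (forall (T : forall n, 'M[R[i]]_(a n)) (S : forall n, 'M[R[i]]_(b n)),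
     in_T T -> in_T S ->
     forall (omegaT : A -> R[i]) (omegaS : B -> R[i]) (omegaTS : AB -> R[i]),
       is_product_state iotaA T omegaT ->
       is_product_state iotaB S omegaS ->
       is_product_state iotaAB (kron_seq T S) omegaTS ->
     forall (H1 H2 H : hilbertType R)
            (piT : A -> H1 -> H1) (OmegaT : H1)
            (piS : B -> H2 -> H2) (OmegaS : H2)
            (piTS : AB -> H -> H) (OmegaTS : H),
       is_gns omegaT piT OmegaT ->
       is_gns omegaS piS OmegaS ->
       is_gns omegaTS piTS OmegaTS ->
     forall (K : hilbertType R) (t : {bilinear H1 -> H2 -> K})
            (Pi : D -> K -> K),
       is_hilbert_tensor t ->
       is_tensor_rep tau t piT piS Pi ->
       unitarily_equivalent (Pi \o phi) piTS).
Proof.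
have ab0 n : (0 < seqmul a b n)%N.
  by rewrite muln_gt0 (ltnW (ha n)) (ltnW (hb n)).
have [[phi_lin phiM phiS [psi _ psiK]] phi_unit] := hphi.
split=> T S hT hS.
  split=> [|omegaT omegaS omegaTS sigma]; first exact: in_T_kron.
  move=> [_ omegaT_unit] [_ omegaS_unit] hTS.
  move=> [[sigma_lin sigma_pos _] sigma_tau].
  apply: (product_state_unique ab0 hAB hTS) => [c x y|x|n j k] /=.
  - by rewrite phi_lin sigma_lin.
  - by rewrite phiM phiS.
  - by rewrite phi_unit sigma_tau omegaT_unit omegaS_unit prod_kron.
move=> omegaT omegaS omegaTS [_ omegaT_unit] [_ omegaS_unit] hTS.
move=> H1 H2 H piT OmT piS OmS piTS OmTS.
move=> [_ denseT gnsT] [_ denseS gnsS] gnsTS.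
move=> K t Pi ht [[Pi_cont Pi_lin PiM PiS] Pi_tau].
have t_inner := ht.1.
have rep : is_rep (Pi \o phi).
  split=> [x|xi c x y|x y xi|x xi eta] /=; first exact: Pi_cont.
  - by rewrite phi_lin Pi_lin.
  - by rewrite phiM PiM.
  - by rewrite phiS PiS.
(* The vector OmT (x) OmS is cyclic and implements omegaTS. *)
apply: (gns_unique (Om := t OmT OmS) _ gnsTS); split=> //.
  apply: (tensor_range_dense ht denseT denseS) => [|c _ _ [x _ <-] [y _ <-]|].
  - have [_ rep_lin _ _] := rep; exists 0 => //.
    by have := zmod_morphism_linear (rep_lin (t OmT OmS)) 0 0; rewrite !subrr.
  - by exists (c *: x + y) => //=; rewrite phi_lin Pi_lin.
  - move=> _ _ [x _ <-] [y _ <-]; exists (psi (tau x y)) => //=.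
    by rewrite psiK Pi_tau.
move=> x /=; apply/esym; move: x; apply/funeqP.
apply: (product_state_unique ab0 hAB hTS) => [c x y|x|n j k] /=.
- by rewrite phi_lin Pi_lin linearDl /= linearZl_LR.
- by rewrite phiM phiS PiM PiS -normr_inner exprn_ge0.
- rewrite phi_unit Pi_tau t_inner -gnsT -gnsS.
  by rewrite omegaT_unit omegaS_unit prod_kron.
Qed.
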